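(* Let $R$ be a Rickart *-ring with proper involution, and let $a,b,x\in R$ with $a\preceq x$ and $b\preceq x$. Then (a) the greatest lower bound $a\curlywedge b$ of $a$ and $b$ in $(R,\preceq)$ exists and equals $x(a''\wedge b'')$; (b) the least upper bound $a\curlyvee b$ of $a$ and $b$ in $(R,\preceq)$ exists and equals $x(a''\vee b'')$. If, moreover, $a,b,x\in S$, then $a\curlywedge b\in S$ and $a\curlyvee b\in S$.
   Context: A *-ring is an associative ring $R$ with an involution $x\mapsto x^*$ (additive, $(xy)^*=y^*x^*$, $x^{**}=x$). A projection is an element $e$ with $e^2=e=e^*$; $P$ denotes the set of projections of $R$. $R$ is a Rickart *-ring if the right annihilator of every element is generated by a projection, i.e. to each $x\in R$ there is a (necessarily unique) projection $x'$ such that for all $y\in R$: $xy=0$ iff $y=x'y$. Then $R$ has the unit $1:=0'$, and $e'=1-e$ for $e\in P$. Write $x'':=(x')'$. $P$ is ordered by $e\le f$ iff $ef=e$ (iff $fe=e$) and is an orthomodular lattice with orthocomplementation $e\mapsto e'$; $\vee,\wedge$ denote its lattice operations. $S:=\{x\in R: x^*=x\}$ is the set of self-adjoint elements. Elements $x,y$ are *-orthogonal, $x\perp y$, if $xy^*=0=x^*y$. The involution is proper if $x^*x=0$ implies $x=0$. The star order on $R$ is the partial order defined by: $x\preceq y$ iff $x\perp y-x$; equivalently, $x^*x=x^*y$ and $xx^*=yx^*$. The symbols $\curlyvee$ and $\curlywedge$ denote the (in general partial) join and meet in $(R,\preceq)$. *)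

(* Defs.v *)
From HB Require Import structures.
From mathcomp Require Import all_boot all_order ssralg.

Set Implicit Arguments.
Unset Strict Implicit.
Unset Printing Implicit Defensive.

Import Order.TTheory GRing.Theory.
Local Open Scope ring_scope.

(* Rings are unital but may be trivial. No generality is lost by assuming a
   unit: see the factory [Zmodule_isRickartStarRing] below. *)
HB.mixin Record PzRing_isStarRing R of GRing.PzRing R := {
  star : R -> R;
  starD : {morph star : x y / x + y};
  starM : forall x y, star (x * y) = star y * star x;
  starK : involutive star
}.

#[short(type="starRingType")]
HB.structure Definition StarRing := {R of GRing.PzRing R & PzRing_isStarRing R}.

Notation "x ^*" := (star x) : ring_scope.

Definition projection (R : starRingType) : pred R :=
  [pred e : R | (e * e == e) && (e^* == e)].

Definition selfadjoint (R : starRingType) : pred R := [pred x : R | x^* == x].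

Definition proper_involution (R : starRingType) : Prop :=
  forall x : R, x^* * x = 0 -> x = 0.

Definition star_orthogonal (R : starRingType) (x y : R) : Prop :=
  x * y^* = 0 /\ x^* * y = 0.

Definition star_le (R : starRingType) (x y : R) : Prop :=
  star_orthogonal x (y - x).

Definition is_star_meet (R : starRingType) (a b m : R) : Prop :=
  [/\ star_le m a, star_le m b &
      forall c, star_le c a -> star_le c b -> star_le c m].

Definition is_star_join (R : starRingType) (a b j : R) : Prop :=
  [/\ star_le a j, star_le b j &
      forall c, star_le a c -> star_le b c -> star_le j c].

(* [rann x] is the projection written x' on paper; it is determined by its
   specification (lemma [rann_uniq]). *)
HB.mixin Record StarRing_isRickart R of StarRing R := {
  rann : R -> R;
  rann_proj : forall x, projection (rann x);
  rannP : forall x y : R, x * y = 0 <-> y = rann x * y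
}.

#[short(type="rickartStarRingType")]
HB.structure Definition RickartStarRing :=
  {R of StarRing R & StarRing_isRickart R}.

(* A Rickart *-ring given without a unit has the unit 0'. *)
HB.factory Record Zmodule_isRickartStarRing R of GRing.Zmodule R := {
  mul : R -> R -> R;
  mulA : associative mul;
  mulDl : left_distributive mul +%R;
  mulDr : right_distributive mul +%R;
  star : R -> R;
  starD : {morph star : x y / x + y};
  starM : forall x y, star (mul x y) = mul (star y) (star x);
  starK : involutive star;
  rann : R -> R;
  rann_proj : forall x, (mul (rann x) (rann x) == rann x) &&
                        (star (rann x) == rann x);
  rannP : forall x y : R, mul x y = 0 <-> y = mul (rann x) y
}.

HB.builders Context R of Zmodule_isRickartStarRing R.

Let mul0 x : mul 0 x = 0.
Proof. by apply: (addrI (mul 0 x)); rewrite -mulDl !addr0. Qed.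

Let mul1 : left_id (rann 0) mul.
Proof. by move=> x; symmetry; apply/(rannP 0 x).1. Qed.

Let mulr1 : right_id (rann 0) mul.
Proof.
move=> x; apply: (can_inj starK).
by case/andP: (rann_proj 0) => _ /eqP s1; rewrite starM s1 mul1.
Qed.

HB.instance Definition _ :=
  GRing.Zmodule_isPzRing.Build R mulA mul1 mulr1 mulDl mulDr.
HB.instance Definition _ := PzRing_isStarRing.Build R starD starM starK.
HB.instance Definition _ := StarRing_isRickart.Build R rann_proj rannP.

HB.end.

Section StarRingTheory.
Variable R : starRingType.
Implicit Types a b m n x y z e : R.

Lemma star0 : (0 : R)^* = 0.
Proof. by apply: (addrI 0^*); rewrite -starD !addr0. Qed.

Lemma starN x : (- x)^* = - x^*.
Proof. by apply: (addrI x^*); rewrite -starD !subrr star0. Qed.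

Lemma starB x y : (x - y)^* = x^* - y^*.
Proof. by rewrite starD starN. Qed.

Lemma star1 : (1 : R)^* = 1.
Proof. by rewrite -[LHS]mulr1 -{2}[1]starK -starM mulr1 starK. Qed.

Lemma projectionP e : reflect (e * e = e /\ e^* = e) (projection e).
Proof. by apply: (iffP andP) => [[/eqP-> /eqP->]|[-> ->]] //; rewrite !eqxx. Qed.

Lemma star_leP x y :
  star_le x y <-> x^* * x = x^* * y /\ x * x^* = y * x^*.
Proof.
rewrite /star_le /star_orthogonal starB !mulrBr.
split=> [[/subr0_eq h1 /subr0_eq h2]|[-> h2]].
  by split=> //; have := congr1 (@star R) h1; rewrite !starM !starK.
by have := congr1 (@star R) h2; rewrite !starM !starK => <-; rewrite !subrr.
Qed.

Lemma star_le_refl x : star_le x x.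
Proof. by rewrite /star_le /star_orthogonal subrr star0 !mulr0. Qed.

Hypothesis properR : proper_involution R.

Lemma star_le_anti x y : star_le x y -> star_le y x -> x = y.
Proof.
move=> /star_leP[h1 _] /star_leP[h2 _]; apply/subr0_eq/properR.
by rewrite starB mulrBl !mulrBr h1 h2 !subrr.
Qed.

Let star_le_trans_half x y z :
  x^* * (y - x) = 0 -> x * (y - x)^* = 0 -> y^* * (z - y) = 0 ->
  x^* * (z - x) = 0.
Proof.
move=> h1 h2 h3.
suff h : x^* * (z - y) = 0.
  by rewrite -[z](subrK y) -addrA mulrDr h h1 addr0.
have h4 : x * (x^* * (z - y)) = 0.
  move/eqP: h2; rewrite starB mulrBr subr_eq0 => /eqP h2.
  by rewrite mulrA -h2 -mulrA h3 mulr0.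
by apply: properR; rewrite starM starK -mulrA h4 mulr0.
Qed.

Lemma star_le_trans y x z : star_le x y -> star_le y z -> star_le x z.
Proof.
move=> [h1 h2] [h3 h4]; split; last exact: star_le_trans_half h2 h1 h4.
have := @star_le_trans_half x^* y^* z^*.
by rewrite -!starB !starK; apply.
Qed.

Lemma is_star_meet_uniq a b m n :
  is_star_meet a b m -> is_star_meet a b n -> m = n.
Proof. by move=> [? ? h] [? ? k]; apply: star_le_anti; auto. Qed.

Lemma is_star_join_uniq a b m n :
  is_star_join a b m -> is_star_join a b n -> m = n.
Proof. by move=> [? ? h] [? ? k]; apply: star_le_anti; auto. Qed.

End StarRingTheory.

Section RickartTheory.
Variable R : rickartStarRingType.
Implicit Types x y e f : R.

Lemma rann_idem x : rann x * rann x = rann x.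
Proof. by have /projectionP[] := rann_proj x. Qed.

Lemma rann_star x : (rann x)^* = rann x.
Proof. by have /projectionP[] := rann_proj x. Qed.

Lemma rann_uniq x e :
  projection e -> (forall y, x * y = 0 <-> y = e * y) -> e = rann x.
Proof.
move=> /projectionP[ee es] eP.
have h1 : e = rann x * e by apply/rannP/eP.
have h2 : rann x = e * rann x by apply/eP/rannP; rewrite rann_idem.
by rewrite -es h1 starM rann_star es -h2.
Qed.

Lemma mul_rann x : x * rann x = 0.
Proof. by apply/rannP; rewrite rann_idem. Qed.

Lemma rann0 : rann (0 : R) = 1.
Proof. by rewrite -[LHS]mulr1; symmetry; apply/rannP; rewrite mul0r. Qed.

Lemma rann_projE e : projection e -> rann e = 1 - e.
Proof.
move=> /projectionP[ee es]; symmetry; apply: rann_uniq => [|y].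
  apply/projectionP; rewrite starB star1 es; split=> //.
  by rewrite mulrBl mul1r mulrBr mulr1 ee subrr subr0.
rewrite mulrBl mul1r; split=> [->|h]; first by rewrite subr0.
by apply: (addrI (y - e * y)); rewrite subrK addr0.
Qed.

End RickartTheory.

Record proj (R : rickartStarRingType) :=
  Proj { proj_val : R; _ : projection proj_val }.

HB.instance Definition _ (R : rickartStarRingType) :=
  [isSub for @proj_val R].
HB.instance Definition _ (R : rickartStarRingType) :=
  [Choice of proj R by <:].

Fact proj_display : Order.disp_t. Proof. exact: Order.Disp tt tt. Qed.

Section ProjectionLattice.
Variable R : rickartStarRingType.
Implicit Types e f g : proj R.

Lemma proj_idem e : proj_val e * proj_val e = proj_val e.
Proof. by have /projectionP[] := valP e. Qed.

Lemma proj_star e : (proj_val e)^* = proj_val e.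
Proof. by have /projectionP[] := valP e. Qed.

Definition proj_le e f : bool := proj_val e * proj_val f == proj_val e.

Lemma proj_leP e f :
  reflect (proj_val f * proj_val e = proj_val e) (proj_le e f).
Proof.
by apply: (iffP eqP) => h; apply: (can_inj (@starK R)); rewrite starM !proj_star.
Qed.

Fact proj_le_refl : reflexive proj_le.
Proof. by move=> e; apply/eqP/proj_idem. Qed.

Fact proj_le_anti : antisymmetric proj_le.
Proof.
by move=> e f /andP[/eqP h /proj_leP k]; apply: val_inj; rewrite /= -h k.
Qed.

Fact proj_le_trans : transitive proj_le.
Proof.
move=> f e g /eqP h /eqP k; apply/eqP.
by rewrite -h -mulrA k.
Qed.

HB.instance Definition _ := Order.Le_isPOrder.Build proj_display (proj R)
  proj_le_refl proj_le_anti proj_le_trans.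

Definition pcompl e : proj R := Proj (rann_proj (proj_val e)).

Lemma pcomplE e : proj_val (pcompl e) = 1 - proj_val e.
Proof. exact: rann_projE (valP e). Qed.

Lemma pcomplK : involutive pcompl.
Proof. by move=> e; apply: val_inj; rewrite -[LHS]/(proj_val _) !pcomplE subKr. Qed.

Lemma pcompl_le e f : proj_le (pcompl e) (pcompl f) = proj_le f e.
Proof.
have -> : proj_le f e = (proj_val e * proj_val f == proj_val f).
  by apply/proj_leP/eqP.
rewrite /proj_le !pcomplE mulrBr mulr1 mulrBl mul1r.
by rewrite -subr_eq0 addrAC subrr add0r oppr_eq0 subr_eq0 eq_sym.
Qed.

Fact pmeet_subproof e f :
  projection (proj_val e * rann (proj_val (pcompl f) * proj_val e)).
Proof.
set x := proj_val (pcompl f) * _; have h : rann (proj_val e) = rann x * rann (proj_val e).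
  by apply/rannP; rewrite /x -mulrA mul_rann mulr0.
have ce : proj_val e * rann x = rann x * proj_val e.
  have := congr1 star h; rewrite starM !rann_star.
  rewrite {1}h (rann_projE (valP e)).
  by rewrite mulrBr mulr1 mulrBl mul1r => /addrI/oppr_inj->.
apply/projectionP; split; last by rewrite starM rann_star proj_star ce.
rewrite {2}ce mulrA -(mulrA (proj_val e)) rann_idem.
by rewrite -mulrA -ce mulrA proj_idem.
Qed.

Definition pmeet e f : proj R := Proj (pmeet_subproof e f).
Definition pjoin e f : proj R := pcompl (pmeet (pcompl e) (pcompl f)).

Fact pmeetP g e f : proj_le g (pmeet e f) = proj_le g e && proj_le g f.
Proof.
have pm_e : proj_le (pmeet e f) e.
  by apply/proj_leP; rewrite /= mulrA proj_idem.
have pm_f : proj_le (pmeet e f) f.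
  apply/proj_leP; have : proj_val (pcompl f) * proj_val (pmeet e f) = 0.
    by rewrite /= mulrA mul_rann.
  by rewrite pcomplE mulrBl mul1r => /subr0_eq <-.
apply/idP/andP => [h|[/proj_leP he /proj_leP hf]].
  by split; [apply: proj_le_trans h pm_e | apply: proj_le_trans h pm_f].
have hx : proj_val g = rann (proj_val (pcompl f) * proj_val e) * proj_val g.
  by apply/rannP; rewrite -mulrA he pcomplE mulrBl mul1r hf subrr.
by apply/proj_leP; rewrite /= -mulrA -hx he.
Qed.

Fact pjoinP e f g : proj_le (pjoin e f) g = proj_le e g && proj_le f g.
Proof. by rewrite -{1}[g]pcomplK pcompl_le pmeetP !pcompl_le. Qed.

HB.instance Definition _ := Order.POrder_MeetJoin_isLattice.Build
  proj_display (proj R) pmeetP pjoinP.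

(* The projection x''. *)
Definition psupp (x : R) : proj R := Proj (rann_proj (rann x)).

End ProjectionLattice.

(* Main.v *)
(* Writing e = a'', the relation a ≼ x forces a = x e with e commuting with
   x^* x; conversely x e ≼ x f whenever e <= f are projections commuting with
   x^* x. Such projections form a sublattice, which reduces meets to P. An upper
   bound c of a and b need not lie below x, but c and x agree on a'' and b'',
   so c - x annihilates a'' \/ b'' and x (a'' \/ b'') = c (a'' \/ b''). Since
   the involution is an automorphism of the star order, it fixes meets and joins
   of self-adjoint elements. *)
Require Import Defs.
From mathcomp Require Import all_boot all_order ssralg.
Import Order.TTheory GRing.Theory.
Local Open Scope ring_scope.

Section StarOrder.
Set Implicit Arguments.
Unset Strict Implicit.
Variable R : starRingType.
Implicit Types a b c m j x y : R.

(** Taking adjoints swaps the two equations of [star_leP]. *)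
Lemma star_le_star x y :
  star_le x y -> star_le x^* y^*.
Proof.
move=> /star_leP[h1 h2]; apply/star_leP; rewrite !starK; split.
  by have := congr1 star h2; rewrite !starM !starK.
by have := congr1 star h1; rewrite !starM !starK.
Qed.

Lemma is_star_meet_star a b m :
  is_star_meet a b m -> is_star_meet a^* b^* m^*.
Proof.
case=> ma mb mP; split; try exact: star_le_star.
move=> c /star_le_star ca /star_le_star cb; rewrite !starK in ca cb.
by rewrite -[c]starK; apply/star_le_star/mP.
Qed.

Lemma is_star_join_star a b j :
  is_star_join a b j -> is_star_join a^* b^* j^*.
Proof.
case=> aj bj jP; split; try exact: star_le_star.
move=> c /star_le_star ac /star_le_star bc; rewrite !starK in ac bc.
by rewrite -[c]starK; apply/star_le_star/jP.
Qed.

End StarOrder.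

Section Rickart.
Set Implicit Arguments.
Unset Strict Implicit.
Variable R : rickartStarRingType.
Implicit Types (a b c s x y z : R) (e f g : proj R).

(** Since z s z' = s z z' = 0, we get s z' = z' s z'. The right side is self-adjoint, so s z' is
    too, which is the commutation. *)
Lemma comm_rann s z : s^* = s -> GRing.comm s z -> GRing.comm s (rann z).
Proof.
move=> ss sz.
have h : s * rann z = rann z * (s * rann z).
  by apply/rannP; rewrite mulrA -sz -mulrA mul_rann mulr0.
have := congr1 (@star R) h; rewrite !starM rann_star ss => h'.
by rewrite /GRing.comm h' -mulrA.
Qed.

Lemma comm_pcompl s e :
  s^* = s -> GRing.comm s (proj_val e) -> GRing.comm s (proj_val (pcompl e)).
Proof. exact: comm_rann. Qed.

Lemma comm_pmeet s e f : s^* = s -> GRing.comm s (proj_val e) ->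
  GRing.comm s (proj_val f) -> GRing.comm s (proj_val (e `&` f)%O).
Proof.
move=> ss se sf; apply: commrM => //; apply: comm_rann => //.
by apply: commrM => //; apply: comm_pcompl.
Qed.

Lemma comm_pjoin s e f : s^* = s -> GRing.comm s (proj_val e) ->
  GRing.comm s (proj_val f) -> GRing.comm s (proj_val (e `|` f)%O).
Proof.
move=> ss se sf; apply: comm_pcompl => //.
by apply: comm_pmeet => //; apply: comm_pcompl.
Qed.

Lemma star_gram x : (x^* * x)^* = x^* * x.
Proof. by rewrite starM starK. Qed.

(** Annihilation becomes an inequality in P, so that joins can be handled by their universal
    property. *)
Lemma mul_proj_eq0 z e : z * proj_val e = 0 <-> (e <= Proj (rann_proj z))%O.
Proof.
split=> [/rannP h|/proj_leP /= h]; first by apply/proj_leP; rewrite /= -h.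
exact/rannP.
Qed.

Lemma mul_pjoin_eq0 z e f : z * proj_val e = 0 -> z * proj_val f = 0 ->
  z * proj_val (e `|` f)%O = 0.
Proof.
move=> /mul_proj_eq0 ze /mul_proj_eq0 zf.
by apply/mul_proj_eq0; rewrite leUx ze zf.
Qed.

Lemma psupp_eq0 x y : proj_val (psupp x) * y = 0 <-> x * y = 0.
Proof.
rewrite /= (rann_projE (rann_proj x)) mulrBl mul1r.
by split=> [/subr0_eq h|/rannP {1}->]; [apply/rannP | rewrite subrr].
Qed.

Lemma mul_psupp x : x * proj_val (psupp x) = x.
Proof.
rewrite /= (rann_projE (rann_proj x)) mulrBr mulr1 mul_rann.
by rewrite subr0.
Qed.

Lemma psupp_le x y : (forall z, y * z = 0 -> x * z = 0) ->
  (psupp x <= psupp y)%O.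
Proof.
move=> h; apply/eqP/esym/subr0_eq.
rewrite -{1}[proj_val (psupp x)]mulr1 -mulrBr; apply/psupp_eq0/h.
by rewrite mulrBr mulr1 mul_psupp subrr.
Qed.

(** From a (x - a)^* = 0 follows a'' (x - a)^* = 0, whose adjoint is (x - a) a'' = 0. *)
Lemma star_le_mul_psupp a x : star_le a x -> x * proj_val (psupp a) = a.
Proof.
move=> [h _]; rewrite -[RHS]mul_psupp; apply/subr0_eq.
rewrite -mulrBl; move/psupp_eq0/(congr1 (@star R)): h.
by rewrite starM starK proj_star star0.
Qed.

(** Both products equal a^* a: x^* x a'' = x^* a = a^* a = a^* x = a'' x^* x. *)
Lemma star_le_comm_psupp a x :
  star_le a x -> GRing.comm (x^* * x) (proj_val (psupp a)).
Proof.
move=> ax; have ax' := star_le_mul_psupp ax.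
have [h _] := (star_leP a x).1 ax.
have h' := congr1 (@star R) h; rewrite !starM !starK in h'.
rewrite /GRing.comm -mulrA ax' -h' h mulrA; congr (_ * _).
by rewrite -{1}ax' starM proj_star.
Qed.

Lemma star_le_mul_proj x e f : GRing.comm (x^* * x) (proj_val e) ->
  (e <= f)%O -> star_le (x * proj_val e) (x * proj_val f).
Proof.
move=> xe ef; have /eqP efE : proj_le e f := ef.
have /proj_leP feE : proj_le e f := ef.
apply/star_leP; rewrite !starM !proj_star; split.
  by rewrite !mulrA -(mulrA _ x^*) -xe -!mulrA efE proj_idem.
by rewrite -!mulrA !(mulrA (proj_val _) (proj_val _)) feE proj_idem.
Qed.

(** The case f = 1 of [star_le_mul_proj], with x in place of x 1. *)
Lemma star_le_mul_projl x e :
  GRing.comm (x^* * x) (proj_val e) -> star_le (x * proj_val e) x.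
Proof.
move=> xe; apply/star_leP; rewrite !starM !proj_star; split.
  by rewrite -!mulrA (mulrA x^*) xe !mulrA proj_idem.
by rewrite -!mulrA (mulrA (proj_val e)) proj_idem.
Qed.

Hypothesis properR : proper_involution R.

(** If x z = 0, then (a z)^* (a z) = z^* a^* x z = 0, and properness gives a z = 0. *)
Lemma psupp_star_le a x : star_le a x -> (psupp a <= psupp x)%O.
Proof.
move=> /star_leP[h _]; apply: psupp_le => z xz.
by apply: properR; rewrite starM -mulrA (mulrA a^*) h -mulrA xz !mulr0.
Qed.

Lemma is_star_meet_mul_pmeet a b x : star_le a x -> star_le b x ->
  is_star_meet a b (x * proj_val (psupp a `&` psupp b)%O).
Proof.
move=> ax bx; have xe := star_le_comm_psupp ax.
have xf := star_le_comm_psupp bx.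
have xm := comm_pmeet (star_gram x) xe xf.
split; first 2 last.
(* A common lower bound c lies below x, so c = x c'' with c'' below both a'' and b''. *)
- move=> c ca cb; have cx := star_le_trans properR ca ax.
  rewrite -{1}(star_le_mul_psupp cx).
  apply: star_le_mul_proj; first exact: star_le_comm_psupp.
  by rewrite lexI !psupp_star_le.
- by rewrite -{2}(star_le_mul_psupp ax); apply/star_le_mul_proj/leIl.
- by rewrite -{2}(star_le_mul_psupp bx); apply/star_le_mul_proj/leIr.
Qed.

Lemma is_star_join_mul_pjoin a b x : star_le a x -> star_le b x ->
  is_star_join a b (x * proj_val (psupp a `|` psupp b)%O).
Proof.
move=> ax bx; split.
- rewrite -{1}(star_le_mul_psupp ax).
  by apply: star_le_mul_proj (leUl _ _); apply: star_le_comm_psupp.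
- rewrite -{1}(star_le_mul_psupp bx).
  by apply: star_le_mul_proj (leUr _ _); apply: star_le_comm_psupp.
move=> c ac bc.
have -> : x * proj_val (psupp a `|` psupp b)%O
        = c * proj_val (psupp a `|` psupp b)%O.
  apply/subr0_eq; rewrite -mulrBl; apply: mul_pjoin_eq0.
    by rewrite mulrBl !star_le_mul_psupp // subrr.
  by rewrite mulrBl !star_le_mul_psupp // subrr.
(* With x replaced by c, the commutation needed is with c^* c; it comes from a ≼ c and b ≼ c. *)
apply: star_le_mul_projl.
by apply: comm_pjoin; rewrite ?star_gram //; apply: star_le_comm_psupp.
Qed.

End Rickart.

Theorem theorem4p2 (R : rickartStarRingType) (properR : proper_involution R)
    (a b x : R) (ax : star_le a x) (bx : star_le b x) :
  [/\ is_star_meet a b (x * proj_val (psupp a `&` psupp b)%O),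
      is_star_join a b (x * proj_val (psupp a `|` psupp b)%O) &
      a \in @selfadjoint R -> b \in @selfadjoint R -> x \in @selfadjoint R ->
      (forall m : R, is_star_meet a b m -> m \in @selfadjoint R) /\
      (forall j : R, is_star_join a b j -> j \in @selfadjoint R)].
Proof.
split; [exact: is_star_meet_mul_pmeet | exact: is_star_join_mul_pjoin |].
move=> /eqP aS /eqP bS _; split=> [m mP|j jP]; apply/eqP.
  (* m^* is a meet of a^* = a and b^* = b, hence equals m by uniqueness. *)
  by apply: (is_star_meet_uniq properR _ mP); rewrite -{1}aS -{1}bS;
     apply: is_star_meet_star.
by apply: (is_star_join_uniq properR _ jP); rewrite -{1}aS -{1}bS;
   apply: is_star_join_star.
Qed.
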